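(* Every $\mathbb{Z}_2^2$-grading of $\mathfrak{h}_3$ with identity component $\{0\}$ is equivalent to the grading defined by $$\Gamma_7(0,0,0)=\{\mathrm{Id},\tau_1(0,0),\tau_2(0,0),\tau_4(0,0)\},$$ where, in the basis $\{X_1,X_2,X_3\}$, $\tau_1(0,0)=\mathrm{diag}(-1,1,-1)$, $\tau_2(0,0)=\mathrm{diag}(1,-1,-1)$ and $\tau_4(0,0)=\mathrm{diag}(-1,-1,1)$.
   Context: $\mathfrak{h}_3$ is the real Heisenberg Lie algebra with basis $X_1,X_2,X_3$ and brackets $[X_1,X_2]=X_3$, $[X_1,X_3]=[X_2,X_3]=0$. A $\mathbb{Z}_2^2$-grading is a vector space decomposition $\mathfrak{h}_3=\bigoplus_{\gamma\in\mathbb{Z}_2^2}\mathfrak{g}_\gamma$ with $[\mathfrak{g}_\gamma,\mathfrak{g}_{\gamma'}]\subset\mathfrak{g}_{\gamma\gamma'}$. The grading defined by a subgroup of $\mathrm{Aut}(\mathfrak{h}_3)$ isomorphic to $\mathbb{Z}_2^2$ is the decomposition of $\mathfrak{h}_3$ into the simultaneous eigenspaces of the subgroup, the identity component being the subspace fixed by the subgroup; the nontrivial components for $\Gamma_7(0,0,0)$ are $\mathbb{R}X_1,\mathbb{R}X_2,\mathbb{R}X_3$. Two $\mathbb{Z}_2^2$-gradings $\bigoplus\mathfrak{g}_\gamma$ and $\bigoplus\mathfrak{g}'_\gamma$ of $\mathfrak{h}_3$ are equivalent if there are $\sigma\in\mathrm{Aut}(\mathfrak{h}_3)$ and an automorphism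 $\pi$ of the group $\mathbb{Z}_2^2$ with $\mathfrak{g}'_{\gamma}=\sigma(\mathfrak{g}_{\pi(\gamma)})$ for all $\gamma$. *)

(* Defs.v *)
From HB Require Import structures.
From mathcomp Require Import all_boot all_order all_algebra.
From mathcomp Require Import reals.

Set Implicit Arguments.
Unset Strict Implicit.
Unset Printing Implicit Defensive.

Import Order.TTheory GRing.Theory Num.Theory.
Local Open Scope ring_scope.

(* The group Z_2^2, written additively: its identity is 0. *)
Notation Z22 := ('Z_2 * 'Z_2)%type.

(* Elements of h_3 are columns of coordinates in the basis X_1, X_2, X_3, so
   that a matrix acts by left multiplication. *)
Notation h3 R := 'cV[R]_3.

Section Heisenberg.
Variable R : realType.
Implicit Types (x y z : h3 R) (s : 'End(h3 R)) (g : Z22 -> {vspace h3 R}).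

Definition X1 : h3 R := delta_mx 0 0.
Definition X2 : h3 R := delta_mx 1 0.
Definition X3 : h3 R := delta_mx 2 0.

Definition bracket x y : h3 R := (x 0 0 * y 1 0 - x 1 0 * y 0 0) *: X3.

Lemma bracket_linearl y : linear (bracket^~ y).
Proof.
move=> a x z; rewrite /bracket !mxE scalerA -scalerDl; congr (_ *: _).
by rewrite !mulrDl opprD addrACA mulrBr !mulrA.
Qed.

Lemma bracket_alt x : bracket x x = 0.
Proof. by rewrite /bracket [x 1 0 * _]mulrC subrr scale0r. Qed.

Lemma bracketC x y : bracket x y = - bracket y x.
Proof.
by rewrite /bracket -scaleNr opprB [x 0 0 * _]mulrC [x 1 0 * _]mulrC.
Qed.

Lemma bracket_jacobi x y z :
  bracket x (bracket y z) + bracket y (bracket z x) + bracket z (bracket x y)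
  = 0.
Proof. by rewrite /bracket !mxE /= !mulr0 !subrr !scale0r !addr0. Qed.

Lemma bracket_X1X2 : bracket X1 X2 = X3.
Proof. by rewrite /bracket !mxE /= mulr1 mulr0 subr0 scale1r. Qed.

Lemma bracket_X1X3 : bracket X1 X3 = 0.
Proof. by rewrite /bracket !mxE /= ?(mulr0, mul0r) subr0 scale0r. Qed.

Lemma bracket_X2X3 : bracket X2 X3 = 0.
Proof. by rewrite /bracket !mxE /= ?(mulr0, mul0r) subr0 scale0r. Qed.

Definition is_aut s : Prop :=
  lker s = 0%VS /\ forall x y, s (bracket x y) = bracket (s x) (s y).

Definition is_grading g : Prop :=
  [/\ directv (\sum_(c : Z22) g c),
      (\sum_(c : Z22) g c)%VS = fullv
    & forall (c d : Z22) x y,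
        x \in g c -> y \in g d -> bracket x y \in g (c + d)].

Definition equiv_grading g g' : Prop :=
  exists (s : 'End(h3 R)) (p : {additive Z22 -> Z22}),
    [/\ is_aut s, bijective p & forall c, g' c = (s @: g (p c))%VS].

(* phi is an isomorphism from Z_2^2 onto Gamma, seen as a subgroup of
   Aut(h_3). *)
Definition Z22_iso (phi : Z22 -> 'End(h3 R)) (Gamma : seq 'End(h3 R)) : Prop :=
  [/\ forall c, is_aut (phi c),
      forall c d, phi (c + d) = (phi c \o phi d)%VF,
      injective phi
    & forall s, s \in Gamma <-> exists c, s = phi c].

(* The character of Z_2^2 attached to c. *)
Definition sign (c d : Z22) : R := (-1) ^+ (c.1 * d.1 + c.2 * d.2)%R.

(* The simultaneous eigenspaces are naturally indexed by the characters of the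
   subgroup. When phi ranges over the isomorphisms from Z_2^2 onto it,
   [eigen_grading phi] ranges over all their labellings by an isomorphism from
   Z_2^2 onto the group of characters. *)
Definition eigen_grading (phi : Z22 -> 'End(h3 R)) : Z22 -> {vspace h3 R} :=
  fun c => (\bigcap_(d : Z22) passmx.leigenspace (phi d) (sign c d))%VS.

Definition diag3 (a b c : R) : 'End(h3 R) :=
  linfun (mulmx (diag_mx (\row_(i < 3) [:: a; b; c]`_i)) : h3 R -> h3 R).

Definition tau1 := diag3 (-1) 1 (-1).
Definition tau2 := diag3 1 (-1) (-1).
Definition tau4 := diag3 (-1) (-1) 1.

Definition Gamma7 : seq 'End(h3 R) := [:: \1%VF; tau1; tau2; tau4].

Lemma diag3E a b c x :
  diag3 a b c x = \col_i ([:: a; b; c]`_i * x i 0).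
Proof.
rewrite lfunE /=; apply/matrixP => i j; rewrite ord1 !mxE.
rewrite (bigD1 i) //= big1 ?addr0 => [|k /negPf ki]; last first.
  by rewrite !mxE eq_sym ki mul0r.
by rewrite !mxE eqxx mulr1n.
Qed.

Lemma diag3_inj a b c a' b' c' :
  diag3 a b c = diag3 a' b' c' -> [/\ a = a', b = b' & c = c'].
Proof.
move=> e; have {}e i : [:: a; b; c]`_i = [:: a'; b'; c']`_i :> R.
  case: (ltnP i 3) => [lti|lei]; last by rewrite !nth_default.
  have /matrixP/(_ (Ordinal lti) 0) :=
      congr1 (fun f : 'End(h3 R) => f (const_mx 1)) e.
  by rewrite !diag3E !mxE /= !mulr1.
by split; [exact: (e 0%N)|exact: (e 1%N)|exact: (e 2%N)].
Qed.

Lemma is_aut_diag3 a b : a != 0 -> b != 0 -> is_aut (diag3 a b (a * b)).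
Proof.
move=> a0 b0; split=> [|x y].
  apply/eqP; rewrite -subv0; apply/subvP => x; rewrite memv_ker memv0.
  rewrite diag3E => /eqP/matrixP e; apply/eqP/matrixP => i j.
  have := e i j; rewrite ord1 !mxE => /eqP; rewrite mulf_eq0 => /orP[|/eqP//].
  by case: i => -[|[|[|//]]] ? /=; rewrite ?mulf_eq0 ?(negPf a0) ?(negPf b0).
rewrite !diag3E /bracket; apply/matrixP => i j; rewrite ord1 !mxE /=.
case: i => -[|[|[|//]]] ? /=; rewrite ?mulr0 ?mulr1 //.
by rewrite mulrBr [a * x _ _ * _]mulrACA [b * x _ _ * _]mulrACA [b * a]mulrC.
Qed.

Lemma Gamma7_Z22 : exists phi, Z22_iso phi Gamma7.
Proof.
have Z2 (P : 'Z_2 -> Prop) : P 0 -> P 1 -> forall c, P c.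
  move=> P0 P1 [[|[|//]] ltc].
    by rewrite (_ : Ordinal ltc = 0) //; apply/val_inj.
  by rewrite (_ : Ordinal ltc = 1) //; apply/val_inj.
pose e (c : 'Z_2) : R := (-1) ^+ c.
have e0 : e 0 = 1 by [].
have e1 : e 1 = -1 by [].
have eD c d : e (c + d) = e c * e d.
  by elim/Z2: c; elim/Z2: d;
  rewrite ?add0r ?addr0 ?e0 ?e1 ?mulrNN ?mulr1 ?mul1r.
have eN0 c : e c != 0 by rewrite expf_neq0 // oppr_eq0 oner_eq0.
have N1 : (-1 : R) <> 1.
  by move=> /eqP; rewrite eq_sym -addr_eq0 -mulr2n pnatr_eq0.
have e_inj : injective e.
  move=> c d; elim/Z2: c; elim/Z2: d; rewrite ?e0 ?e1 // => h;
  by case: N1.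
pose phi (c : Z22) := diag3 (e c.1) (e c.2) (e c.1 * e c.2).
have phi0 : phi 0 = \1%VF.
  apply/lfunP => x; rewrite diag3E id_lfunE; apply/matrixP => i j.
  rewrite ord1 mxE /= e0 mulr1.
  by case: i => -[|[|[|//]]] ? /=; rewrite mul1r.
have phi1 : phi (1, 0) = tau1 by rewrite /phi /= e0 e1 mulr1.
have phi2 : phi (0, 1) = tau2 by rewrite /phi /= e0 e1 mul1r.
have phi4 : phi (1, 1) = tau4 by rewrite /phi /= e1 mulrNN mulr1.
exists phi; split.
- by move=> c; apply: is_aut_diag3.
- move=> c d; apply/lfunP => x; rewrite comp_lfunE !diag3E.
  apply/matrixP => i j; rewrite !mxE /= !eD.
  by case: i => -[|[|[|//]]] ? /=; rewrite !mulrA // [_ * e c.2]mulrAC.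
- by move=> [c c'] [d d'] /diag3_inj[/e_inj /= -> /e_inj /= -> _].
- move=> s; rewrite !inE; split=> [/or4P[]/eqP->|[[c d] ->]].
  + by exists 0.
  + by exists (1, 0).
  + by exists (0, 1).
  + by exists (1, 1).
  by elim/Z2: c; elim/Z2: d; rewrite ?phi0 ?phi1 ?phi2 ?phi4 eqxx ?orbT.
Qed.

End Heisenberg.

(* Main.v *)
(** If the identity component vanishes, then every component is abelian, being
    bracketed into it.  As h_3 is not abelian there are homogeneous u, v with
    [u, v] <> 0, of degrees a <> b, and then u, v, [u, v] is a homogeneous basis
    whose degrees a, b, a + b are the three nonzero elements of Z_2^2.  The
    linear map u, v, [u, v] |-> X_1, X_2, X_3 is an automorphism of h_3 and
    carries the grading to that of Gamma_7, up to relabelling. *)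

Require Import Defs.
From HB Require Import structures.
From mathcomp Require Import all_boot all_order all_algebra.
From mathcomp Require Import reals ring zify.
Import GRing.Theory.
Local Open Scope ring_scope.

(** * The group Z_2^2 as a plane over the field with two elements *)

Lemma Z2_ind (P : 'Z_2 -> Prop) : P 0 -> P 1 -> forall i, P i.
Proof.
move=> P0 P1 [[|[|//]] lti].
- by rewrite (_ : Ordinal lti = 0) //; apply/val_inj.
- by rewrite (_ : Ordinal lti = 1) //; apply/val_inj.
Qed.

Lemma Z22_ind (P : Z22 -> Prop) :
  P (0, 0) -> P (0, 1) -> P (1, 0) -> P (1, 1) -> forall c, P c.
Proof. by move=> P00 P01 P10 P11 [i j]; elim/Z2_ind: i; elim/Z2_ind: j. Qed.

(** Linear independence: over the field with two elements the only scalars are 0 and 1, so two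
    nonzero distinct vectors form a basis. *)
Definition Z22_free (c d : Z22) : bool := [&& c != 0, d != 0 & c != d].

Definition Z22_det (c d : Z22) : 'Z_2 := c.1 * d.2 - c.2 * d.1.

Lemma Z22_free_det c d : Z22_free c d = (Z22_det c d == 1).
Proof. by elim/Z22_ind: c; elim/Z22_ind: d. Qed.

Lemma Z22_free_span c d e :
  Z22_free c d -> e \in [:: 0; c; d; c + d].
Proof. by elim/Z22_ind: c; elim/Z22_ind: d; elim/Z22_ind: e. Qed.

Lemma Z22_free_add c d : Z22_free c d -> [/\ c + d != 0, c + d != c & c + d != d].
Proof. by elim/Z22_ind: c; elim/Z22_ind: d. Qed.

(* By Cramer's rule, this sends c1 to a and c2 to b when (c1, c2) is a basis. *)
Definition Z22_map (c1 c2 a b c : Z22) : Z22 :=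
  (Z22_det c c2 * a.1 + Z22_det c1 c * b.1,
   Z22_det c c2 * a.2 + Z22_det c1 c * b.2).

Lemma Z22_map_is_zmod_morphism c1 c2 a b : zmod_morphism (Z22_map c1 c2 a b).
Proof.
move=> c d; rewrite /Z22_map /Z22_det.
by congr (_, _); rewrite /=; ring.
Qed.

HB.instance Definition _ (c1 c2 a b : Z22) :=
  GRing.isZmodMorphism.Build Z22 Z22 (Z22_map c1 c2 a b)
    (Z22_map_is_zmod_morphism c1 c2 a b).

Lemma Z22_map_free c1 c2 a b :
  Z22_free c1 c2 -> Z22_map c1 c2 a b c1 = a /\ Z22_map c1 c2 a b c2 = b.
Proof.
rewrite Z22_free_det /Z22_map => /eqP ->; rewrite /Z22_det.
rewrite [c1.1 * c1.2]mulrC [c2.1 * c2.2]mulrC !subrr.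
by rewrite !mul1r !mul0r !addr0 !add0r -!surjective_pairing.
Qed.

(** On a finite group injectivity suffices, and the kernel is trivial because the nonzero elements
    [c1], [c2], [c1 + c2] go to the nonzero elements [a], [b], [a + b]. *)
Lemma Z22_map_bij c1 c2 a b :
  Z22_free c1 c2 -> Z22_free a b -> bijective (Z22_map c1 c2 a b).
Proof.
move=> fc fab; have [pc1 pc2] := Z22_map_free c1 c2 a b fc.
have /and3P[a0 b0 _] := fab; have [ab0 _ _] := Z22_free_add a b fab.
apply/injF_bij/raddf_inj => c.
have := Z22_free_span _ _ c fc; rewrite !inE => /or4P[]/eqP-> //.
- by rewrite /= pc1 => /eqP; rewrite (negPf a0).
- by rewrite /= pc2 => /eqP; rewrite (negPf b0).
- by rewrite raddfD /= pc1 pc2 => /eqP; rewrite (negPf ab0).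
Qed.

Definition Z22_dot (c d : Z22) : 'Z_2 := c.1 * d.1 + c.2 * d.2.

(** Dependent vectors span at most a line, whose orthogonal complement in the plane is nonzero. *)
Lemma Z22_orthogonal c d :
  ~~ Z22_free c d ->
  exists e, [/\ e != 0, Z22_dot c e = 0 & Z22_dot d e = 0].
Proof.
rewrite Z22_free_det => /eqP det0.
have {}det0 : Z22_det c d = 0 by elim/Z2_ind: (Z22_det c d) det0.
have [c0|c0] := eqVneq c 0; last first.
  (* This vector is always orthogonal to [c]; its product with [d] is minus the determinant, hence
     0. *)
  exists (c.2, - c.1); rewrite /Z22_dot /=; split; last 2 first.
  - by ring.
  - by rewrite -[RHS]oppr0 -det0 /Z22_det; ring.
  by case: c c0 {det0} => [i j]; elim/Z2_ind: i; elim/Z2_ind: j.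
rewrite c0; elim/Z22_ind: d {det0}.
- by exists (1, 0); split=> //; apply/eqP.
- by exists (1, 0); split=> //; apply/eqP.
- by exists (0, 1); split=> //; apply/eqP.
- by exists (1, 1); split=> //; apply/eqP.
Qed.

Section Heisenberg.
Variable R : realType.
Implicit Types (x y z u v : h3 R) (c d a b : Z22).

(** * Characters of Z_2^2 and coordinates in h_3 *)

Lemma signr_Z2D (i j : 'Z_2) : (-1) ^+ (i + j)%R = (-1) ^+ i * (-1) ^+ j :> R.
Proof.
by elim/Z2_ind: i; elim/Z2_ind: j; rewrite ?addr0 ?add0r ?mulr1 ?mul1r ?mulrNN
  ?mulr1.
Qed.

Lemma signr_Z2_inj : injective (fun i : 'Z_2 => (-1) ^+ i : R).
Proof.
have N1 : (-1 : R) <> 1.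
  by move=> /eqP; rewrite eq_sym -addr_eq0 -mulr2n Num.Theory.pnatr_eq0.
by move=> i j; elim/Z2_ind: i; elim/Z2_ind: j => // /esym; rewrite ?expr1 => /N1.
Qed.

(** The values of a character on the two generators recover the coordinates of its label. *)
Lemma sign_inj c d : (forall e, sign R c e = sign R d e) -> c = d.
Proof.
move=> e_cd; have e1 := signr_Z2_inj _ _ (e_cd (1, 0)).
have e2 := signr_Z2_inj _ _ (e_cd (0, 1)).
rewrite [c]surjective_pairing [d]surjective_pairing; congr (_, _).
- by rewrite !mulr1 !mulr0 !addr0 in e1.
- by rewrite !mulr1 !mulr0 !add0r in e2.
Qed.

Lemma ord3P (P : 'I_3 -> Prop) : P 0 -> P 1 -> P 2 -> forall i, P i.
Proof.
move=> P0 P1 P2 [[|[|[|//]]] lti].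
- by rewrite (_ : Ordinal lti = 0) //; apply/val_inj.
- by rewrite (_ : Ordinal lti = 1) //; apply/val_inj.
- by rewrite (_ : Ordinal lti = 2) //; apply/val_inj.
Qed.

Lemma h3P x y :
  x 0 0 = y 0 0 -> x 1 0 = y 1 0 -> x 2 0 = y 2 0 -> x = y.
Proof. by move=> ? ? ?; apply/matrixP => i j; rewrite ord1; elim/ord3P: i. Qed.

Lemma bracketDl y : {morph (@bracket R)^~ y : x z / x + z}.
Proof.
by move=> x z; have := bracket_linearl y 1 x z; rewrite !scale1r.
Qed.

Lemma bracketDr x : {morph @bracket R x : y z / y + z}.
Proof.
by move=> y z; rewrite bracketC bracketDl opprD ![bracket x _]bracketC.
Qed.

Lemma bracket0l y : bracket 0 y = 0.
Proof. by rewrite /bracket !mxE !mul0r subrr scale0r. Qed.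

Lemma bracket0r x : bracket x 0 = 0.
Proof. by rewrite bracketC bracket0l oppr0. Qed.

Lemma dim_h3 : \dim (fullv : {vspace h3 R}) = 3%N.
Proof. by rewrite dimvf dim_matrix. Qed.

(** * Gradings with zero identity component *)

Lemma grading_noncommuting (g : Z22 -> {vspace h3 R}) :
  is_grading g ->
  exists a b u v, [/\ u \in g a, v \in g b & bracket u v != 0].
Proof.
case=> _ gT _.
have /memv_sumP[us usP X1E] : X1 R \in (\sum_(c : Z22) g c)%VS.
  by rewrite gT memvf.
have /memv_sumP[vs vsP X2E] : X2 R \in (\sum_(c : Z22) g c)%VS.
  by rewrite gT memvf.
(* If all homogeneous components of [X1] and [X2] commuted, bilinearity would give
   [bracket X1 X2 = 0], whereas its third coordinate is 1. *)
case: (pickP (fun ab => bracket (us ab.1) (vs ab.2) != 0)) => [[a b] /= uv0|uv0].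
  by exists a, b, (us a), (vs b); rewrite usP ?vsP.
have /matrixP/(_ 2 0)/eqP := bracket_X1X2 R.
rewrite X1E (big_morph _ (bracketDl _) (bracket0l _)) big1 ?mxE.
  by rewrite eq_sym oner_eq0.
move=> a _; rewrite X2E (big_morph _ (bracketDr _) (bracket0r _)) big1 // => b _.
exact/eqP/negPn/negbT/(uv0 (a, b)).
Qed.

Lemma grading_frame (g : Z22 -> {vspace h3 R}) :
  is_grading g -> g 0 = 0%VS ->
  exists a b u v, [/\ Z22_free a b, bracket u v != 0,
    g a = <[u]>%VS, g b = <[v]>%VS & g (a + b) = <[bracket u v]>%VS].
Proof.
move=> g_grading g0.
have [a [b [u [v [ga gb uv0]]]]] := grading_noncommuting g g_grading.
have [gD gT gM] := g_grading.
have addcc c : c + c = 0 by apply/eqP; elim/Z22_ind: c.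
have gab := gM _ _ _ _ ga gb.
have nz c x : x \in g c -> x != 0 -> c != 0.
  by move=> gx; apply: contraNneq => c0; rewrite c0 g0 memv0 in gx.
have u0 : u != 0 by apply: contraNneq uv0 => ->; rewrite bracket0l.
have v0 : v != 0 by apply: contraNneq uv0 => ->; rewrite bracket0r.
(* Equal degrees would put [bracket u v] in [g (a + a) = g 0], which is zero. *)
have ab : a != b.
  apply: contraNneq uv0 => ab; move: gab.
  by rewrite ab addcc g0 memv0.
have fab : Z22_free a b by rewrite /Z22_free (nz _ _ ga) // (nz _ _ gb).
have [_ aba abb] := Z22_free_add a b fab.
exists a, b, u, v.
have dim_g c x : x \in g c -> x != 0 -> (0 < \dim (g c))%N.
  move=> gx x0; rewrite lt0n dimv_eq0; apply: contraNneq x0 => gc0.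
  by rewrite gc0 memv0 in gx.
(* The degrees [a], [b], [a + b] are distinct, so they index three separate terms of a direct sum of
   dimension 3. Each term is nonzero, so each is a line. *)
have dim_sum : (\dim (g a) + \dim (g b) + \dim (g (a + b)%R) <= 3)%N.
  move: gD; rewrite directvE /= gT dim_h3 => /eqP dim3; rewrite [leqRHS]dim3.
  rewrite (bigD1 a) //= (bigD1 b) ?(eq_sym b) //= (bigD1 (a + b)) ?aba ?abb //=.
  by rewrite !addnA leq_addr.
have lines c x : x \in g c -> x != 0 -> (\dim (g c) <= 1)%N -> g c = <[x]>%VS.
  move=> gx x0 dim1; apply/esym/eqP; rewrite eqEdim -memvE gx dim_vline x0.
  exact: dim1.
have da := dim_g _ _ ga u0; have db := dim_g _ _ gb v0.
have dab := dim_g _ _ gab uv0.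
split=> //; apply: lines => //; lia.
Qed.

(** * The eigenspace grading of [Gamma7] *)

Lemma diag3_comp (p q r p' q' r' : R) :
  (diag3 p q r \o diag3 p' q' r')%VF = diag3 (p * p') (q * q') (r * r').
Proof.
apply/lfunP => x; rewrite comp_lfunE !diag3E.
by apply: h3P; rewrite !mxE /= mulrA.
Qed.

Lemma Gamma7_diag3 s :
  s \in Gamma7 R ->
  exists i j : 'Z_2, s = diag3 ((-1) ^+ i) ((-1) ^+ j) ((-1) ^+ (i + j)%R).
Proof.
rewrite !inE => /or4P[]/eqP->.
- exists 0, 0; apply/lfunP => x; rewrite id_lfunE diag3E.
  by apply: h3P; rewrite mxE mul1r.
- by exists 1, 0.
- by exists 0, 1.
- by exists 1, 1.
Qed.

(** Each diagonal entry of [phi d] is a character in [d]. The entry at [X3] is the product of the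
    other two, so its label is the sum of theirs. *)
Lemma Z22_iso_diag3 (phi : Z22 -> 'End(h3 R)) :
  Z22_iso phi (Gamma7 R) ->
  exists c1 c2, Z22_free c1 c2 /\
    forall d, phi d = diag3 (sign R c1 d) (sign R c2 d) (sign R (c1 + c2) d).
Proof.
case=> _ phiD phi_inj phi_im.
have phi_Gamma d : phi d \in Gamma7 R by apply/phi_im; exists d.
have [i [j phi10]] := Gamma7_diag3 _ (phi_Gamma (1, 0)).
have [k [l phi01]] := Gamma7_diag3 _ (phi_Gamma (0, 1)).
have signE i' j' k' l' :
    sign R (i', j') (k', l') = (-1) ^+ (i' * k' + j' * l')%R by [].
have sign3 d : sign R (i + j, k + l) d = sign R (i, k) d * sign R (j, l) d.
  by rewrite -signr_Z2D; congr (_ ^+ nat_of_ord _); rewrite /=; ring.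
(* The label of the character on [X1] collects the [X1] exponents [i], [k] of the two generators;
   that on [X2] collects [j], [l]. *)
have phiE d : phi d =
    diag3 (sign R (i, k) d) (sign R (j, l) d) (sign R (i + j, k + l) d).
  have phi00 : phi (0, 0) = diag3 1 1 1.
    rewrite (_ : (0, 0) = (1, 0) + (1, 0) :> Z22); last exact/eqP.
    by rewrite phiD phi10 diag3_comp -!expr2 !sqrr_sign.
  elim/Z22_ind: d.
  - by rewrite phi00 !signE !mulr0 !addr0.
  - by rewrite phi01 !signE !mulr0 !mulr1 !add0r.
  - by rewrite phi10 !signE !mulr0 !mulr1 !addr0.
  - rewrite [phi _](_ : _ = phi ((0, 1) + (1, 0))); last by congr phi; exact/eqP.
    rewrite phiD phi01 phi10 diag3_comp -!signr_Z2D.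
    by rewrite !signE !mulr1 [k + i]addrC [l + j]addrC [k + l + _]addrC.
exists (i, k), (j, l); split=> //.
(* Were the labels dependent, some nonzero [e] would be killed by all three characters, so that
   [phi e = phi 0], against injectivity. *)
apply: contraT => /Z22_orthogonal[e [/eqP e0 ike jle]]; case: e0; apply: phi_inj.
have dot0 c : Z22_dot c 0 = 0 by apply/eqP; elim/Z22_ind: c.
have sign_dot c d : sign R c d = (-1) ^+ Z22_dot c d by [].
by rewrite !phiE !sign3 !sign_dot ike jle !dot0.
Qed.

(** The eigenvector condition splits by coordinates: a nonzero coordinate forces the character
    acting on it to agree with that of [c] at every [d], hence the labels to coincide. *)
Lemma eigen_gradingP (phi : Z22 -> 'End(h3 R)) (c1 c2 c3 c : Z22) x :
  (forall d, phi d = diag3 (sign R c1 d) (sign R c2 d) (sign R c3 d)) ->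
  reflect [/\ x 0 0 = 0 \/ c = c1, x 1 0 = 0 \/ c = c2 & x 2 0 = 0 \/ c = c3]
    (x \in eigen_grading phi c).
Proof.
move=> phiE; rewrite memvE.
have eigP d : (<[x]> <= passmx.leigenspace (phi d) (sign R c d))%VS =
    (phi d x == sign R c d *: x).
  by rewrite -memvE memv_ker !lfun_simp subr_eq0.
have coordP (t : R) e :
    (forall d, sign R e d * t = sign R c d * t) -> t = 0 \/ c = e.
  have [->|t0] := eqVneq t 0; [by left|right].
  by apply: sign_inj => d; apply: (mulIf t0).
apply: (iffP subv_bigcapP) => [xP|[x1 x2 x3] d _].
  have {}xP d := xP d isT.
  split; apply: coordP => d; have := xP d;
    rewrite eigP phiE diag3E => /eqP/matrixP.
  - by move/(_ 0 0); rewrite !mxE.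
  - by move/(_ 1 0); rewrite !mxE.
  - by move/(_ 2 0); rewrite !mxE.
rewrite eigP phiE diag3E; apply/eqP/h3P; rewrite !mxE /=.
- by case: x1 => [->|->//]; rewrite !mulr0.
- by case: x2 => [->|->//]; rewrite !mulr0.
- by case: x3 => [->|->//]; rewrite !mulr0.
Qed.

(** The labels [0], [c1], [c2], [c1 + c2] are distinct, so at most one coordinate survives in each
    eigenspace, and none at [0]. *)
Lemma eigen_grading_frame (phi : Z22 -> 'End(h3 R)) :
  Z22_iso phi (Gamma7 R) ->
  exists c1 c2, Z22_free c1 c2 /\
    [/\ eigen_grading phi 0 = 0%VS, eigen_grading phi c1 = <[X1 R]>%VS,
        eigen_grading phi c2 = <[X2 R]>%VS &
        eigen_grading phi (c1 + c2) = <[X3 R]>%VS].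
Proof.
move=> /Z22_iso_diag3[c1 [c2 [fc phiE]]]; exists c1, c2; split=> //.
have EP c x := eigen_gradingP phi c1 c2 (c1 + c2) c x phiE.
have /and3P[/eqP c10 /eqP c20 /eqP c12] := fc.
have [/eqP c30 /eqP c31 /eqP c32] := Z22_free_add c1 c2 fc.
split; apply/vspaceP => x; apply/EP/idP.
- case=> -[x1|/esym//] [x2|/esym//] [x3|/esym//].
  by rewrite memv0; apply/eqP/h3P; rewrite mxE.
- by rewrite memv0 => /eqP->; rewrite !mxE; split; left.
- case=> _ [x2|//] [x3|/esym//]; apply/vlineP; exists (x 0 0).
  by apply: h3P; rewrite !mxE /= ?mulr1 ?mulr0.
- by case/vlineP => k ->; rewrite !mxE /= !mulr0; split; [right|left|left].
- case=> [[x1|/esym//] _ [x3|/esym//]]; apply/vlineP; exists (x 1 0).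
  by apply: h3P; rewrite !mxE /= ?mulr1 ?mulr0.
- by case/vlineP => k ->; rewrite !mxE /= !mulr0; split; [left|right|left].
- case=> [[x1|//] [x2|//] _]; apply/vlineP; exists (x 2 0).
  by apply: h3P; rewrite !mxE /= ?mulr1 ?mulr0.
- by case/vlineP => k ->; rewrite !mxE /= !mulr0; split; [left|left|right].
Qed.

(** * The automorphism carrying a homogeneous frame to the standard basis *)

(** This is the inverse of the automorphism sought: the direction from the standard basis to the
    frame has an explicit formula in coordinates. *)
Definition frame_fun u v x : h3 R :=
  x 0 0 *: u + x 1 0 *: v + x 2 0 *: bracket u v.

Lemma frame_fun_is_linear u v : linear (frame_fun u v).
Proof.
move=> k x y; rewrite /frame_fun /bracket.
by apply: h3P; rewrite !mxE /=; ring.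
Qed.

HB.instance Definition _ u v := GRing.isLinear.Build R (h3 R) (h3 R) _
  (frame_fun u v) (frame_fun_is_linear u v).

(** Since [bracket u v] is central, both sides equal [bracket u v] scaled by the determinant of the
    first two coordinates of [x] and [y]. *)
Lemma frame_fun_bracket u v x y :
  frame_fun u v (bracket x y) = bracket (frame_fun u v x) (frame_fun u v y).
Proof. by rewrite /frame_fun /bracket; apply: h3P; rewrite !mxE /=; ring. Qed.

Lemma frame_fun_ker u v x : bracket u v != 0 -> frame_fun u v x = 0 -> x = 0.
Proof.
rewrite /bracket scaler_eq0 negb_or => /andP[uv0 _] /matrixP x0.
have := x0 0 0; have := x0 1 0; have := x0 2 0.
rewrite !mxE /= !mulr0 !addr0 !mulr1.
move=> x0_2 x0_1 x0_0.
(* As [bracket u v] is a multiple of [X3], the first two coordinates form a 2 by 2 homogeneous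
   system with determinant [uv0]; Cramer's rule solves it. The third coordinate then gives
   [x 2 0]. *)
have x1 : x 0 0 = 0.
  apply: (mulIf uv0); rewrite mul0r.
  transitivity (v 1 0 * (x 0 0 * u 0 0 + x 1 0 * v 0 0)
    - v 0 0 * (x 0 0 * u 1 0 + x 1 0 * v 1 0)); first by ring.
  by rewrite x0_0 x0_1 !mulr0 subr0.
have x2 : x 1 0 = 0.
  apply: (mulIf uv0); rewrite mul0r.
  transitivity (u 0 0 * (x 0 0 * u 1 0 + x 1 0 * v 1 0)
    - u 1 0 * (x 0 0 * u 0 0 + x 1 0 * v 0 0)); first by ring.
  by rewrite x0_0 x0_1 !mulr0 subr0.
apply: h3P; rewrite ?x1 ?x2 ?mxE //; apply: (mulIf uv0).
by rewrite mul0r -x0_2 x1 x2 !mul0r !add0r.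
Qed.

Lemma is_aut_inv (s : 'End(h3 R)) : is_aut s -> is_aut s^-1%VF.
Proof.
case=> /eqP ker_s sM.
have sK := lker0_lfunK ker_s; have sVK := lker0_lfunVK ker_s.
split=> [|x y]; last by rewrite -{1}[x]sVK -{1}[y]sVK -sM sK.
apply/eqP; rewrite -subv0; apply/subvP => x.
by rewrite memv_ker memv0 => /eqP sx0; rewrite -[x]sVK sx0 linear0.
Qed.

Lemma frame_aut u v :
  bracket u v != 0 ->
  exists2 s : 'End(h3 R), is_aut s &
    [/\ s u = X1 R, s v = X2 R & s (bracket u v) = X3 R].
Proof.
move=> uv0; pose t : 'End(h3 R) := linfun (frame_fun u v).
have tE x : t x = frame_fun u v x by rewrite lfunE.
have t_aut : is_aut t.
  split=> [|x y]; last by rewrite !tE frame_fun_bracket.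
  apply/eqP; rewrite -subv0; apply/subvP => x.
  rewrite memv_ker memv0 tE => /eqP tx0.
  by rewrite (frame_fun_ker u v x).
have ker_t : lker t == 0%VS by apply/eqP; case: t_aut.
exists t^-1%VF; first exact: is_aut_inv.
(* Applying the injective map [t] to both sides leaves its values on the standard basis to
   compute. *)
split; apply: (can_inj (lker0_lfunK ker_t)); rewrite lker0_lfunVK // tE /frame_fun;
  by rewrite !mxE /= !scale0r !scale1r ?addr0 ?add0r.
Qed.

End Heisenberg.

Theorem proposition3p4 (R : realType) (g : Z22 -> {vspace h3 R})
    (g_grading : is_grading g) (g_id : g 0 = 0%VS)
    (phi : Z22 -> 'End(h3 R)) (phi_iso : Z22_iso phi (Gamma7 R)) :
  equiv_grading g (eigen_grading phi).
Proof.
have [a [b [u [v [fab uv0 ga gb gab]]]]] := grading_frame _ g g_grading g_id.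
have [c1 [c2 [fc [E0 E1 E2 E3]]]] := eigen_grading_frame _ phi phi_iso.
have [s s_aut [su sv suv]] := frame_aut _ u v uv0.
have [pc1 pc2] := Z22_map_free c1 c2 a b fc.
(* The relabelling goes from the degrees of the eigenspaces to those of [g]: [c1] to [a] and [c2] to
   [b]. The equality of components is then checked on [0], [c1], [c2] and [c1 + c2], which exhaust
   Z_2^2. *)
exists s, (Z22_map c1 c2 a b); split=> // [|c]; first exact: Z22_map_bij.
have := Z22_free_span _ _ c fc; rewrite !inE => /or4P[]/eqP->.
- by rewrite raddf0 g_id limg0.
- by rewrite /= pc1 ga limg_line su.
- by rewrite /= pc2 gb limg_line sv.
- by rewrite raddfD /= pc1 pc2 gab limg_line suv.
Qed.
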